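(* Let $R$ be an ordered set, $f:\{0,1\}^n\to R$, and $\varepsilon\in(0,1)$. Consider the following algorithm Unate-test$(f,\varepsilon)$: for each $r=1,2,\ldots,L$ where $L=\lceil \log_2(8n/\varepsilon)\rceil$, repeat $s_r=\lceil 20n/(\varepsilon\cdot 2^r)\rceil$ times the following: (a) sample a dimension $i\in[n]$ uniformly at random; (b) sample a set $R_i$ of $3\cdot 2^r$ independent uniformly random points of $\{0,1\}^n$ and evaluate $\partial_i f$ at all these points; (c) if there exist $x\in R_i$ with $\partial_i f(x)>0$ and $y\in R_i$ with $\partial_i f(y)<0$, reject and abort. If the algorithm has not rejected after all iterations, it accepts. Then, if $f$ is $\varepsilon$-far from being unate, Unate-test$(f,\varepsilon)$ rejects with probability at least $1-1/e$.
   Context: For $x\in\{0,1\}^n$ and $i\in[n]$, let $e_i$ be the unit vector with $1$ in coordinate $i$. The $i$-th partial derivative of $f$ at $x$ is $\partial_i f(x) = f(x\oplus e_i)-f(x)$ if $x_i=0$ and $\partial_i f(x)= f(x)-f(x\oplus e_i)$ if $x_i=1$ (its sign is determined by comparing $f(x)$ and $f(x\oplus e_i)$ in the order of $R$). A function $f:\{0,1\}^n\to R$ is unate if for every $i\in[n]$, either $\partial_i f(x)\ge 0$ for all $x$, or $\partial_i f(x)\le 0$ for all $x$. The function $f$ is $\varepsilon$-far from unate if every unate $g:\{0,1\}^n\to R$ differs from $f$ on at least an $\varepsilon$ fraction of the points of $\{0,1\}^n$. *)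

(* Defs.v *)
From HB Require Import structures.
From mathcomp Require Import all_boot all_order all_algebra.
From mathcomp Require Import reals sequences exp.

Set Implicit Arguments.
Unset Strict Implicit.
Unset Printing Implicit Defensive.

Import Order.TTheory GRing.Theory Num.Theory.
Local Open Scope ring_scope.

Definition cube (n : nat) := {ffun 'I_n -> bool}.

(* x (+) e_i *)
Definition flip (n : nat) (x : cube n) (i : 'I_n) : cube n :=
  [ffun j => x j (+) (j == i)].

(* The sign of "b - a" in a totally ordered set, where the difference itself
   need not make sense. *)
Definition diff_sign (d : Order.disp_t) (R : orderType d) (b a : R) : int :=
  if (a < b)%O then 1 else if (b < a)%O then -1 else 0.

(* Only the sign of a partial derivative is meaningful for a range R without
   subtraction, and only the sign is used below. *)
Definition partial (d : Order.disp_t) (R : orderType d) (n : nat)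
    (f : cube n -> R) (i : 'I_n) (x : cube n) : int :=
  if x i then diff_sign (f x) (f (flip x i))
  else diff_sign (f (flip x i)) (f x).

Definition unate (d : Order.disp_t) (R : orderType d) (n : nat)
    (f : cube n -> R) : Prop :=
  forall i : 'I_n,
    (forall x, 0 <= partial f i x) \/ (forall x, partial f i x <= 0).

Definition far_from_unate (K : realType) (d : Order.disp_t) (R : orderType d)
    (n : nat) (eps : K) (f : cube n -> R) : Prop :=
  forall g : cube n -> R, unate g ->
    eps <= #|[set x | f x != g x]|%:R / #|{: cube n}|%:R.

(* Finite randomized computations: [Sample k] draws a uniformly random t : T,
   independently of all previous draws, and continues as [k t]. *)
Inductive rand (A : Type) : Type :=
| Ret (a : A)
| Sample (T : finType) (k : T -> rand A).

Arguments Ret {A} a.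
Arguments Sample {A T} k.

Fixpoint bind (A B : Type) (p : rand A) (q : A -> rand B) : rand B :=
  match p with
  | Ret a => q a
  | Sample T k => Sample (fun t : T => bind (k t) q)
  end.

(* Probability that the output of p satisfies E.  Sampling from an empty type
   has no probabilistic meaning; by x / 0 = 0 it gets total mass 0. *)
Fixpoint Pr (K : realType) (A : Type) (p : rand A) (E : pred A) : K :=
  match p with
  | Ret a => (E a)%:R
  | Sample T k => (\sum_(t : T) Pr K (k t) E) / #|T|%:R
  end.

Variant verdict := Accept | Reject.

Definition rejects (v : verdict) : bool := if v is Reject then true else false.

Definition iteration (d : Order.disp_t) (R : orderType d) (n : nat)
    (f : cube n -> R) (r : nat) : rand verdict :=
  Sample (fun i : 'I_n =>
  Sample (fun Ri : (3 * 2 ^ r)%N.-tuple (cube n) =>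
    Ret (if has (fun x => 0 < partial f i x) Ri
            && has (fun y => partial f i y < 0) Ri
         then Reject else Accept))).

(* Runs the given testers in order, stopping at the first rejection. *)
Fixpoint run_until_reject (ps : seq (rand verdict)) : rand verdict :=
  match ps with
  | [::] => Ret Accept
  | p :: ps' => bind p (fun v =>
      match v with
      | Reject => Ret Reject
      | Accept => run_until_reject ps'
      end)
  end.

(* The arguments of the two ceilings below are nonnegative when n > 0 and
   0 < eps < 1, so taking the absolute value loses nothing. *)
Definition num_rounds (K : realType) (n : nat) (eps : K) : nat :=
  `|Num.ceil (ln (8 * n%:R / eps) / ln 2)|%N.

Definition num_iterations (K : realType) (n : nat) (eps : K) (r : nat) : nat :=
  `|Num.ceil (20 * n%:R / (eps * 2 ^+ r))|%N.

Definition unate_test (K : realType) (d : Order.disp_t) (R : orderType d)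
    (n : nat) (f : cube n -> R) (eps : K) : rand verdict :=
  run_until_reject
    (flatten [seq nseq (num_iterations n eps r) (iteration f r)
             | r <- iota 1 (num_rounds n eps)]).

(* Main.v *)
Require Import Defs.
From mathcomp Require Import all_boot all_order all_algebra.
From mathcomp Require Import reals sequences exp.
From mathcomp Require Import zify ring lra.

(**
Fix an orientation b of the n directions and refine f to an integer-valued F
without ties on edges.  Among the functions monotone for b take G closest to F
in l1 distance.  Raising (lowering) G by 1 on part of a level set does not
help, so by Hall's theorem the points with F > G inject upwards within the level
sets of G into points with F <= G (map phi), and dually the points with F < G
inject downwards (map psi).  Following a non-violated i-edge and then phi or psi
injects part of the non-violated points of a suitable set into that set,
and the image misses all phi x and psi x that differ from x in direction i.
Hence direction i has at least as many violated points as there are such x,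
and summing over i bounds the distance from f to unate by the total number of
violated points.  Choosing b to minimise it shows that, with mu_i the smaller of
the fractions of points where f increases and decreases in direction i, the
sum of the mu_i is at least eps.

An iteration of round r that samples i with mu_i >= 2^-r rejects with
probability at least 1 - 2 (1 - 2^-r)^(3 2^r) >= 3/4, and sum_r 2^-r over the
rounds r with 2^-r <= mu_i is at least (mu_i - 2^-L) / 2.  So the rejection
probabilities of all iterations add up to at least 1, and
prod (1 - p) <= exp (- sum p).
*)

Set Implicit Arguments.
Unset Strict Implicit.

(** * Hall's marriage theorem *)

Section Hall.
Variable T : finType.
Implicit Types (A S : {set T}) (N : T -> {set T}).

(* Halmos-Vaughan: split A at a set where Hall's condition is tight, or else
   match one point arbitrarily. *)
Lemma hall A N :
    (forall S, S \subset A -> #|S| <= #|\bigcup_(x in S) N x|) ->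
  exists2 phi : T -> T, {in A &, injective phi} & {in A, forall x, phi x \in N x}.
Proof.
have [m] := ubnP #|A|; elim: m A N => // m IH A N /ltnSE cardA hallA.
have [->|[a aA]] := set_0Vmem A; first by exists id => [x y|x]; rewrite inE.
have glue S (phi psi : T -> T) : S \subset A ->
    {in S &, injective phi} -> {in S, forall x, phi x \in N x} ->
    {in A :\: S &, injective psi} ->
    {in A :\: S, forall x, psi x \in N x :\: \bigcup_(y in S) [set phi y]} ->
  exists2 phi : T -> T, {in A &, injective phi} & {in A, forall x, phi x \in N x}.
  move=> SA phi_inj phiN psi_inj psiN.
  have neq x y : x \in S -> y \in A -> y \notin S -> phi x != psi y.
    move=> xS yA yS; have := psiN y; rewrite !inE yA yS => /(_ isT) /andP[nphi _].
    by apply: contraNneq nphi => <-; apply/bigcupP; exists x => //; rewrite inE.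
  exists (fun x => if x \in S then phi x else psi x) => [x y xA yA|x xA].
    case: ifPn => xS; case: ifPn => yS.
    - exact: phi_inj.
    - by move=> e; have := neq _ _ xS yA yS; rewrite e eqxx.
    - by move=> e; have := neq _ _ yS xA xS; rewrite e eqxx.
    - by apply: psi_inj; rewrite !inE ?xA ?yA ?xS ?yS.
  case: ifPn => xS; first exact: phiN.
  by have := psiN x; rewrite !inE xS xA => /(_ isT) /andP[].
have [tight|loose] := boolP [exists S : {set T},
  [&& S != set0, S \proper A & #|\bigcup_(x in S) N x| <= #|S|]].
- have /existsP[S /and3P[S0 SpA NS]] := tight.
  have SA := proper_sub SpA.
  have [|U US|phi phi_inj phiN] := IH S N.
  + exact: leq_trans (proper_card SpA) cardA.
  + exact: hallA (subset_trans US SA).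
  pose N' x := N x :\: \bigcup_(y in S) N y.
  have [|U UAS|psi psi_inj psiN] := IH (A :\: S) N'.
  + by rewrite cardsDS // (leq_trans _ cardA) // ltn_subrL !card_gt0 S0 -card_gt0 (cardD1 a) aA.
  (* Hall's condition for [S :|: U] suffices: tightness lets [S] use up at most [#|S|] of the
     neighbours, so at least [#|U|] remain. *)
  + rewrite -(leq_add2l #|S|).
    have dSU : S :&: U = set0.
      apply/setP=> x; rewrite !inE; apply/negP=> /andP[xS /(subsetP UAS)].
      by rewrite !inE xS.
    rewrite -cardsUI dSU cards0 addn0.
    have /hallA : S :|: U \subset A by rewrite subUset SA (subset_trans UAS) ?subsetDl.
    move=> /leq_trans; apply.
    have -> : \bigcup_(x in S :|: U) N x =
        \bigcup_(x in S) N x :|: \bigcup_(x in U) N' x.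
      apply/setP=> y; rewrite inE; apply/bigcupP/orP => [[x]|].
        rewrite inE => /orP[xS yN|xU yN]; first by left; apply/bigcupP; exists x.
        case: (boolP (y \in \bigcup_(z in S) N z)) => yS; [by left|right].
        by apply/bigcupP; exists x; rewrite // inE yS.
      case=> /bigcupP[x xS yN]; exists x; rewrite ?inE ?xS ?orbT //.
      by move: yN; rewrite inE => /andP[].
    by rewrite (leq_trans (leq_card_setU _ _).1) // leq_add2r.
  apply: (glue S phi psi) => // x xAS.
  have := psiN x xAS; rewrite !inE => /andP[nN ->]; rewrite andbT.
  apply: contraNN nN => /bigcupP[y yS]; rewrite inE => /eqP ->.
  by apply/bigcupP; exists y => //; apply: phiN.
- have /hallA: [set a] \subset A by rewrite sub1set.
  rewrite cards1 big_set1 => /card_gt0P[b bN].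
  pose N' x := N x :\ b.
  have [|U UA|psi psi_inj psiN] := IH (A :\ a) N'.
  + by rewrite (leq_trans _ cardA) // (cardsD1 a A) aA.
  + have -> : \bigcup_(x in U) N' x = (\bigcup_(x in U) N x) :\ b.
      apply/setP=> y; rewrite !inE; apply/bigcupP/andP => [[x xU]|[yb /bigcupP[x xU yN]]].
        by rewrite !inE => /andP[-> yN]; split=> //; apply/bigcupP; exists x.
      by exists x => //; rewrite !inE yb.
    have [->|U0] := eqVneq U set0; first by rewrite cards0.
    (* Since [U] is not tight, it has a spare neighbour, which pays for the removal of [b]. *)
    have := loose; rewrite negb_exists => /forallP/(_ U).
    rewrite U0 (sub_proper_trans UA (properD1 aA)) /= -ltnNge.
    by rewrite (cardsD1 b (\bigcup_(x in U) N x)); case: (b \in _); rewrite ?add0n // => /ltnW.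
  apply: (glue [set a] (fun=> b) psi) => //; rewrite ?sub1set //.
  + by move=> x y; rewrite !inE => /eqP-> /eqP->.
  + by move=> x; rewrite inE => /eqP ->.
  + by move=> x xA; have := psiN x xA; rewrite big_set1.
Qed.
End Hall.

Import Order.TTheory GRing.Theory Num.Theory.
Local Open Scope ring_scope.

(** * Monotone integer approximation in l1 distance on a finite preorder *)

Section Approximation.
Variable T : finType.
Implicit Types (le : rel T) (F G : T -> int) (S : {set T}).

Definition nondecr le G := forall x y, le x y -> G x <= G y.
Definition l1dist F G := (\sum_x `|(F x - G x)%R|)%N.
Definition receivers le F G x := [set y | [&& le x y, G y == G x & F y <= G y]].
Definition hall_cond le F G :=
  [forall S : {set T}, (S \subset [set x | G x < F x]) ==>
     (#|S| <= #|\bigcup_(x in S) receivers le F G x|)%N].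

(** If [S] violates Hall's condition, raise [G] by 1 on the upward closure [U] of [S] within level
    sets. [G] stays monotone because a relation leaving [U] strictly increases [G], by at least 1.
    The error drops by 1 where [G < F] on [U], in particular on [S], and grows by 1 on the rest of
    [U], which consists of receivers and so has fewer than [#|S|] points. *)
Lemma hall_cond_or_closer le F G :
    reflexive le -> transitive le -> nondecr le G ->
  hall_cond le F G \/ exists2 G', nondecr le G' & (l1dist F G' < l1dist F G)%N.
Proof.
move=> le_refl le_trans G_mono.
have [|] := boolP (hall_cond le F G); [by left | move=> hF; right].
move: hF; rewrite negb_forall => /existsP[S]; rewrite negb_imply -ltnNge => /andP[SA NS].
pose U := [set y | [exists x in S, le x y && (G y == G x)]].
pose A := [set x | G x < F x].
have inU y : reflect (exists2 x, x \in S & le x y /\ G y = G x) (y \in U).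
  rewrite inE; apply: (iffP existsP) => [[x /and3P[xS xy /eqP e]]|[x xS [xy e]]].
    by exists x.
  by exists x; rewrite xS xy e eqxx.
pose G' x := G x + (x \in U)%:Z.
exists G'.
  rewrite /G' => x y xy; have := G_mono x y xy.
  have [xU|] := boolP (x \in U); have [yU|yU] := boolP (y \in U) => //= *; try lia.
  suff: G x != G y by lia.
  apply: contraNneq yU => e; have /inU[z zS [zx ez]] := xU.
  by apply/inU; exists z => //; rewrite -e; split=> //; apply: le_trans zx xy.
have SU : (#|S| <= #|U :&: A|)%N.
  apply: subset_leq_card; apply/subsetP => x xS; rewrite inE (subsetP SA) // andbT.
  by apply/inU; exists x.
have UN : (#|U :\: A| <= #|\bigcup_(x in S) receivers le F G x|)%N.
  apply: subset_leq_card; apply/subsetP => y; rewrite !inE -leNgt => /andP[FG].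
  move=> /existsP[x /and3P[xS xy e]].
  by apply/bigcupP; exists x; rewrite // inE xy e.
suff: (l1dist F G' + #|U :&: A| = l1dist F G + #|U :\: A|)%N by lia.
rewrite /l1dist -!sum1_card [X in (_ + X)%N]big_mkcond [X in _ = (_ + X)%N]big_mkcond.
rewrite -!big_split /= /G'; apply: eq_bigr => x _.
by rewrite in_setI in_setD [x \in A]inE; case: (x \in U); case: ltP => /= FG; lia.
Qed.

(* For the converse of le, - F and - G, this says that phi pushes the points
   with F < G downwards. *)
Definition pushes le F G (phi : T -> T) :=
  {in [set x | G x < F x] &, injective phi} /\
  forall x, G x < F x -> [/\ le x (phi x), G (phi x) = G x & F (phi x) <= G (phi x)].

Lemma hall_cond_pushes le F G : hall_cond le F G -> exists phi, pushes le F G phi.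
Proof.
move=> /forallP hF.
have [S SA|phi phi_inj phiN] := @hall T [set x | G x < F x] (receivers le F G).
  by have := hF S; rewrite SA.
exists phi; split=> // x xA; have := phiN x; rewrite !inE => /(_ xA) /and3P[? /eqP ? ?].
by split.
Qed.

(** Descent on [l1dist F G] from the zero function. Improvements for the negated functions over the
    converse order decrease the same distance, so the process ends at one [G] satisfying both Hall
    conditions. *)
Lemma nondecr_approximation le F : reflexive le -> transitive le ->
  exists G phi psi, [/\ nondecr le G, pushes le F G phi
    & pushes (fun x y => le y x) (fun x => - F x) (fun x => - G x) psi].
Proof.
move=> le_refl le_trans.
have [G [G_mono hF hFN]] : exists G, [/\ nondecr le G, hall_cond le F G
    & hall_cond (fun x y => le y x) (fun x => - F x) (fun x => - G x)].
  have: nondecr le (fun=> 0) by [].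
  move: (fun=> 0) => G; have [m] := ubnP (l1dist F G); elim: m G => // m IH G ltG G_mono.
  have [hF|[G' G'_mono ltG']] := @hall_cond_or_closer le F G le_refl le_trans G_mono; last first.
    by apply: (IH G') => //; apply: leq_trans ltG' _.
  have [|||hFN|[G' G'_mono ltG']] := @hall_cond_or_closer (fun x y => le y x) (fun x => - F x) (fun x => - G x).
  - exact: le_refl.
  - by move=> y x z /= yx zy; apply: le_trans zy yx.
  - by move=> x y yx; rewrite lerN2; apply: G_mono.
  - by exists G.
  apply: (IH (fun x => - G' x)).
    suff e H H' : l1dist (fun x => - H x) H' = l1dist H (fun x => - H' x).
      rewrite -e; apply: leq_trans ltG' _; rewrite e.
      by move: ltG; rewrite ltnS; congr (_ <= _)%N; apply: eq_bigr => x _; rewrite opprK.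
    by apply: eq_bigr => x _; rewrite opprK -opprD abszN.
  by move=> x y xy; rewrite lerN2; apply: G'_mono.
have [phi hphi] := hall_cond_pushes hF; have [psi hpsi] := hall_cond_pushes hFN.
by exists G, phi, psi.
Qed.
End Approximation.

(** * Violated points and distance to monotonicity on the oriented cube *)

Section Cube.
Variable n : nat.
Implicit Types (Z : {set cube n}) (b x y : cube n) (phi psi : cube n -> cube n) (i : 'I_n) (F G : cube n -> int).

Lemma flipE x i j : flip x i j = x j (+) (j == i).
Proof. by rewrite ffunE. Qed.

Lemma flipK i : involutive (fun x => flip x i).
Proof. by move=> x; apply/ffunP=> j; rewrite !flipE addbK. Qed.

(* The coordinatewise order of the cube with the directions i such that b i
   reversed. *)
Definition cube_le b x y := [forall j, (x j (+) b j) ==> (y j (+) b j)].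

Lemma cube_leP b x y :
  reflect (forall j, x j (+) b j -> y j (+) b j) (cube_le b x y).
Proof. exact: 'forall_implyP. Qed.

Lemma cube_le_refl b : reflexive (cube_le b).
Proof. by move=> x; apply/cube_leP. Qed.

Lemma cube_le_trans b : transitive (cube_le b).
Proof. by move=> y x z /cube_leP xy /cube_leP yz; apply/cube_leP=> j /xy/yz. Qed.

Definition compl b : cube n := [ffun j => ~~ b j].

Lemma cube_le_compl b x y : cube_le (compl b) x y = cube_le b y x.
Proof.
by apply: eq_forallb => j; rewrite ffunE; case: (x j); case: (y j); case: (b j).
Qed.

Lemma cube_le_flip b x i : cube_le b x (flip x i) = ~~ (x i (+) b i).
Proof.
apply/cube_leP/idP => [/(_ i)|xi j]; rewrite flipE.
  by rewrite eqxx; case: (x i); case: (b i) => // /(_ isT).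
by case: eqVneq => [->|_]; rewrite ?addbF // (negPf xi).
Qed.

Lemma cube_le_flip2 b x y i : ~~ (x i (+) b i) -> y i (+) b i ->
  cube_le b x y -> cube_le b (flip x i) y /\ cube_le b x (flip y i).
Proof.
move=> xi yi /cube_leP xy; split; apply/cube_leP=> j; rewrite flipE.
  by case: eqVneq => [->|_]; rewrite ?yi ?addbF //; apply: xy.
by case: eqVneq => [->|_]; rewrite ?(negPf xi) ?addbF //; apply: xy.
Qed.

(** Together with [end_pts] this is a dual pair: complementing [b] and negating [F] and [G]
    exchanges the two sets. *)
Definition start_pts b F G i : {set cube n} :=
  [set x : cube n | [&& ~~ (x i (+) b i), G x <= F x & G (flip x i) == G x]].

Definition end_pts b F G i : {set cube n} :=
  [set x : cube n | [&& x i (+) b i, F x <= G x & G (flip x i) == G x]].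

Definition rising F i Z : {set cube n} := [set x : cube n in Z | F x < F (flip x i)].
Definition falling F i Z : {set cube n} := [set x : cube n in Z | F (flip x i) < F x].
Definition above F G : {set cube n} := [set x : cube n | G x < F x].
Definition moved phi i Z : {set cube n} := [set x : cube n in Z | phi x i != x i].

(* The points flip x i, for x a rising starting point, and the points that phi
   moves in direction i are disjoint sets of points where G < F, and phi maps
   both into end_pts: flipping such an image back in direction i gives a point
   between two points of the same level of G. *)
Lemma card_crossing_pushes b F G phi i :
    nondecr (cube_le b) G -> pushes (cube_le b) F G phi ->
  (#|rising F i (start_pts b F G i)| + #|moved phi i (above F G)| <= #|end_pts b F G i|)%N.
Proof.
move=> G_mono [phi_inj phiP].
pose P := rising F i (start_pts b F G i).
pose Q := moved phi i (above F G).
have QE (x : cube n) : x \in Q -> [/\ G x < F x, ~~ (x i (+) b i) & phi x i (+) b i].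
  rewrite !inE => /andP[xA]; have [/cube_leP/(_ i) + _ _] := phiP x xA.
  by case: (x i); case: (phi x i); case: (b i) => // /(_ isT).
have PE (x : cube n) : x \in P -> [/\ G (flip x i) < F (flip x i), flip x i i (+) b i & G (flip x i) = G x].
  rewrite !inE => /andP[/and3P[xi GF /eqP e] lt]; split=> //.
    by rewrite e; apply: le_lt_trans GF lt.
  by rewrite flipE eqxx addbT addNb.
have dPQ : (fun x => flip x i) @: P :&: Q = set0.
  apply/setP=> x; rewrite in_setI in_set0; apply/negP=> /andP[/imsetP[y /PE[_ yi _] ->]].
  by move=> /QE[_ /negP].
have PQA : (fun x => flip x i) @: P :|: Q \subset [set x | G x < F x].
  apply/subsetP=> x; rewrite [x \in _ :|: _]inE => /orP[/imsetP[y /PE[yA _ _] ->]|/QE[xA _ _]];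
    by rewrite inE.
rewrite -(card_imset P (can_inj (flipK i))) -cardsUI dPQ cards0 addn0.
rewrite -(card_in_imset (f := phi)); last first.
  by move=> x y /(subsetP PQA) xA /(subsetP PQA) yA; apply: phi_inj.
apply: subset_leq_card; apply/subsetP=> _ /imsetP[x xPQ ->].
have : G x < F x by have := subsetP PQA x xPQ; rewrite inE.
case/phiP=> le_x eG leF; rewrite inE leF /=.
suff [xi [z [le_z Gz]]] : phi x i (+) b i /\
    exists z, cube_le b z (flip (phi x) i) /\ G z = G x.
  rewrite xi eq_le {2}eG -Gz [G z <= _]G_mono // andbT; apply: G_mono.
  by rewrite -{2}[phi x](flipK i) cube_le_flip flipE eqxx addbT addNb xi.
move: xPQ; rewrite inE => /orP[/imsetP[y /PE[_ yi Gy] e]|/QE[xA xi pxi]]; last first.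
  by split=> //; exists x; split=> //; have [] := cube_le_flip2 xi pxi le_x.
(* Here [x] is already a top end in direction [i], so it cannot lie below the flipped image; its
   bottom neighbour [y], on the same level of [G], takes its place. *)
have pxi : phi x i (+) b i by apply: (cube_leP _ _ _ le_x); rewrite e.
split=> //; exists y; split; last by rewrite e.
have yi' : ~~ (y i (+) b i) by move: yi; rewrite flipE eqxx addbT addNb.
have : cube_le b y (phi x).
  by apply: cube_le_trans le_x; rewrite e cube_le_flip.
by case/(cube_le_flip2 yi' pxi).
Qed.

(** Both ends of a violated edge are counted, as in [increases] and [decreases] below. *)
Definition violations b F i : {set cube n} :=
  [set x : cube n | if x i (+) b i then F x < F (flip x i) else F (flip x i) < F x].

(** Add the crossing bound to its dual. Without ties, every start or end point is rising or falling;
    cancelling the rising start points and the falling end points leaves falling start points and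
    rising end points on the right. These are disjoint sets of violations. *)
Lemma card_crossing_le b F G phi psi i :
    (forall x, F (flip x i) != F x) ->
    nondecr (cube_le b) G -> pushes (cube_le b) F G phi ->
    pushes (fun x y => cube_le b y x) (fun x => - F x) (fun x => - G x) psi ->
  (#|moved phi i (above F G)| + #|moved psi i (above G F)| <= #|violations b F i|)%N.
Proof.
move=> F_neq G_mono hphi hpsi.
have up := card_crossing_pushes i G_mono hphi.
have := @card_crossing_pushes (compl b) (fun x => - F x) (fun x => - G x) psi i.
have -> : start_pts (compl b) (fun x => - F x) (fun x => - G x) i = end_pts b F G i.
  by apply/setP=> x; rewrite !inE ffunE addbN negbK lerN2 eqr_opp.
have -> : end_pts (compl b) (fun x => - F x) (fun x => - G x) i = start_pts b F G i.
  by apply/setP=> x; rewrite !inE ffunE addbN lerN2 eqr_opp.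
move=> down.
have {}down : (#|falling F i (end_pts b F G i)| + #|moved psi i (above G F)|
    <= #|start_pts b F G i|)%N.
  have -> : falling F i (end_pts b F G i) = rising (fun x => - F x) i (end_pts b F G i).
    by apply/setP=> x; rewrite !inE ltrN2.
  have -> : above G F = above (fun x => - F x) (fun x => - G x).
    by apply/setP=> x; rewrite !inE ltrN2.
  apply: down => [x y|]; first by rewrite cube_le_compl lerN2; apply: G_mono.
  case: hpsi => inj hpsi; split=> // x /hpsi[le_x eG leF].
  by split; rewrite ?cube_le_compl.
have split_pts Z : (#|Z| <= #|rising F i Z| + #|falling F i Z|)%N.
  rewrite -cardsUI (leq_trans _ (leq_addr _ _)) // subset_leq_card //.
  by apply/subsetP=> x xZ; rewrite !inE xZ /=; case: ltgtP (F_neq x).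
have: (#|falling F i (start_pts b F G i)| + #|rising F i (end_pts b F G i)|
    <= #|violations b F i|)%N.
  rewrite -cardsUI [X in (_ + X)%N](_ : _ = 0%N) ?addn0; last first.
    by apply/eqP; rewrite cards_eq0; apply/eqP/setP=> x; rewrite !inE; case: (_ (+) _); rewrite //= andbF.
  apply: subset_leq_card; apply/subsetP=> x; rewrite !inE.
  by case: (_ (+) _); rewrite /= ?orbF => /andP[].
have := split_pts (start_pts b F G i); have := split_pts (end_pts b F G i).
lia.
Qed.

Lemma card_le_sum_moved phi Z : (forall x, x \in Z -> phi x != x) ->
  (#|Z| <= \sum_i #|moved phi i Z|)%N.
Proof.
move=> hZ; rewrite -sum1_card.
rewrite (eq_bigr (fun i => (\sum_(x in Z) (phi x i != x i))%N)) => [|i _]; last first.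
  rewrite -sum1_card big_mkcond [RHS]big_mkcond; apply: eq_bigr => x _; rewrite inE.
  by case: (x \in Z); case: (phi x i != x i).
rewrite exchange_big /=; apply: leq_sum => x /hZ hx.
have [i hi] : exists i, phi x i != x i.
  apply/existsP; rewrite -negb_forall; apply: contraNN hx => /forallP e.
  by apply/eqP/ffunP=> i; apply/eqP.
by rewrite (bigD1 i) //= hi.
Qed.

(** A point with [F != G] is not fixed by the relevant map, since its image is on the other side of
    [G]; so it is moved in some direction and gets counted there. *)
Lemma cube_nondecr_approximation b F : (forall x i, F (flip x i) != F x) ->
  exists2 G, nondecr (cube_le b) G &
    (#|[set x | F x != G x]| <= \sum_i #|violations b F i|)%N.
Proof.
move=> F_neq; have [G [phi [psi [G_mono hphi hpsi]]]] :=
  nondecr_approximation F (@cube_le_refl b) (@cube_le_trans b).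
exists G => //.
apply: (@leq_trans (\sum_i (#|moved phi i (above F G)| + #|moved psi i (above G F)|))%N);
  last by apply: leq_sum => i _; apply: card_crossing_le (F_neq ^~ i) G_mono hphi hpsi.
rewrite big_split /=.
have -> : [set x | F x != G x] = above F G :|: above G F.
  by apply/setP=> x; rewrite !inE; case: ltgtP.
rewrite (leq_trans (leq_card_setU _ _).1) // leq_add // card_le_sum_moved // => x; rewrite inE => lt.
  by case: hphi => _ /(_ x lt)[_ eG le]; apply: contraTneq lt => e; rewrite -leNgt -{1}e -{2}e.
case: hpsi => _ /(_ x); rewrite ltrN2 lerN2 => /(_ lt)[_ /oppr_inj eG le].
by apply: contraTneq lt => e; rewrite -leNgt -{1}e -{2}e.
Qed.
End Cube.

(** * Distance to unateness for values in an ordered set *)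

Section Distance.
Variables (d : Order.disp_t) (R : orderType d) (n : nat) (f : cube n -> R).
Implicit Types (b x y : cube n) (i : 'I_n).

Definition increases i : {set cube n} := [set x : cube n | 0 < partial f i x].
Definition decreases i : {set cube n} := [set x : cube n | partial f i x < 0].

Lemma diff_sign_gt0 (a c : R) : (0 < diff_sign c a) = (a < c)%O.
Proof. by rewrite /diff_sign; case: (ltgtP a c). Qed.

Lemma diff_sign_lt0 (a c : R) : (diff_sign c a < 0) = (c < a)%O.
Proof. by rewrite /diff_sign; case: (ltgtP a c). Qed.

(** An order-preserving passage from [R], which has no arithmetic, to numbers. *)
Definition rank x := #|[set z : cube n | (f z < f x)%O]|.
Definition weight b x := #|[set j : 'I_n | x j (+) b j]|.
(* Lexicographic in (rank x, weight b x): ties of f become increases along b. *)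
Definition refined_rank b x : int := (rank x * n.+1 + weight b x)%N.

Lemma ltn_rank x y : (f x < f y)%O -> (rank x < rank y)%N.
Proof.
move=> fxy; apply: proper_card; apply/properP; split.
  by apply/subsetP=> z; rewrite !inE => /lt_trans; apply.
by exists x; rewrite inE ?ltxx.
Qed.

Lemma refined_rank_lt b x y : (f x < f y)%O -> refined_rank b x < refined_rank b y.
Proof.
move=> /ltn_rank rxy; rewrite ltz_nat.
have wx : (weight b x <= n)%N by rewrite -[X in (_ <= X)%N]card_ord max_card.
rewrite (@leq_trans ((rank x).+1 * n.+1))%N //; first by rewrite mulSn; lia.
by rewrite (leq_trans _ (leq_addr _ _)) // leq_mul2r rxy orbT.
Qed.

Lemma refined_rank_le b x y : refined_rank b x <= refined_rank b y -> (f x <= f y)%O.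
Proof. by apply: contraTT; rewrite -!ltNge; apply: refined_rank_lt. Qed.

Lemma weight_flip b x i : ~~ (x i (+) b i) -> (weight b x < weight b (flip x i))%N.
Proof.
move=> xi; apply: proper_card; apply/properP; split.
  by apply/subsetP=> j; rewrite !inE flipE; case: eqVneq => [->|]; rewrite ?(negPf xi) ?addbF.
by exists i; rewrite inE // flipE eqxx addbT addNb.
Qed.

(** Ties are broken upwards along [b], so they create no new violations. *)
Lemma refined_rank_flip b x i : ~~ (x i (+) b i) ->
  (refined_rank b (flip x i) < refined_rank b x) = (f (flip x i) < f x)%O /\
  refined_rank b (flip x i) != refined_rank b x.
Proof.
move=> /weight_flip w; case: (ltgtP (f (flip x i)) (f x)) => [lt|lt|e].
- by have := refined_rank_lt b lt; case: ltgtP.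
- by have := refined_rank_lt b lt; case: ltgtP.
have: refined_rank b x < refined_rank b (flip x i).
  by rewrite /refined_rank /rank e ltz_nat ltn_add2l.
by case: ltgtP.
Qed.

Lemma refined_rank_flip_neq b x i : refined_rank b (flip x i) != refined_rank b x.
Proof.
have [xi|xi] := boolP (x i (+) b i); last by case: (refined_rank_flip xi).
have yi : ~~ (flip x i i (+) b i) by rewrite flipE eqxx addbT addNb xi.
by have [_] := refined_rank_flip yi; rewrite flipK eq_sym.
Qed.

Lemma violations_refined_rank b i :
  violations b (refined_rank b) i = if b i then increases i else decreases i.
Proof.
apply/setP=> x; rewrite inE.
have -> : (x \in if b i then increases i else decreases i) =
    if x i (+) b i then (f x < f (flip x i))%O else (f (flip x i) < f x)%O.
  by case: ifP => bi; rewrite inE /partial; case: ifP; rewrite ?(diff_sign_gt0, diff_sign_lt0).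
case: ifPn => xi; last by case: (refined_rank_flip xi).
have yi : ~~ (flip x i i (+) b i) by rewrite flipE eqxx addbT addNb xi.
by have [+ _] := refined_rank_flip yi; rewrite flipK.
Qed.

Lemma unate_of_nondecr b (g : cube n -> R) :
  (forall x y, cube_le b x y -> (g x <= g y)%O) -> unate g.
Proof.
move=> g_mono i.
have up x : ~~ (x i (+) b i) -> (g x <= g (flip x i))%O.
  by move=> xi; apply: g_mono; rewrite cube_le_flip.
have down x : x i (+) b i -> (g (flip x i) <= g x)%O.
  move=> xi; rewrite -{2}[x](flipK i); apply: up.
  by rewrite flipE eqxx addbT addNb xi.
have [bi|bi] := boolP (b i); [right|left] => x; rewrite leNgt /partial;
  case: ifPn => xi; rewrite ?(diff_sign_gt0, diff_sign_lt0) -leNgt;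
  do [apply: up | apply: down];
  by rewrite ?bi ?(negPf bi) ?xi ?(negPf xi).
Qed.

(** The integer approximation [G] is carried back to [R] by keeping [f] on the set [S] where [G]
    equals the refined rank, where [f] is monotone, and extending by maxima over lower points of
    [S]. *)
Lemma unate_approximation b : exists2 g : cube n -> R, unate g &
  (#|[set x | f x != g x]| <= \sum_i #|if b i then increases i else decreases i|)%N.
Proof.
have [G G_mono cardG] := cube_nondecr_approximation b (refined_rank_flip_neq b).
pose S : {set cube n} := [set x | refined_rank b x == G x].
(* [R] may have no least element; the least value of [f] serves as the empty maximum. *)
pose m := \big[Order.min/f [ffun=> false]]_x f x.
pose g x := \big[Order.max/m]_(s in S | cube_le b s x) f s.
exists g.
  apply: (@unate_of_nondecr b) => x y xy; apply: sub_bigmax => s /andP[-> /=] sx.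
  exact: cube_le_trans sx xy.
under eq_bigr do rewrite -violations_refined_rank.
apply: leq_trans cardG; apply: subset_leq_card; apply/subsetP=> x; rewrite !inE.
apply: contraNN => xS; apply/eqP/le_anti/andP; split.
  by apply: (@le_bigmax_cond _ _ _ _ x); rewrite inE xS cube_le_refl.
apply: bigmax_le => [|s /andP[]]; first exact: bigmin_le.
rewrite inE => /eqP sS /G_mono; rewrite -sS -(eqP xS); exact: refined_rank_le.
Qed.

Lemma far_from_unate_le (K : realType) (eps : K) : far_from_unate eps f ->
  eps * #|{: cube n}|%:R <= (\sum_i minn #|increases i| #|decreases i|)%:R.
Proof.
(* In each direction [b] makes the rarer sign the violating one. *)
move=> far; pose b : cube n := [ffun i => #|increases i| < #|decreases i|]%N.
have [g g_unate] := unate_approximation b.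
have /far := g_unate; rewrite ler_pdivlMr ?ltr0n; last first.
  by apply/card_gt0P; exists [ffun=> false].
move=> /le_trans h leg; apply: h; rewrite ler_nat (leq_trans leg) //.
by apply: leq_sum => i _; rewrite ffunE /minn; case: ifP.
Qed.
End Distance.

(** * Probability of rejection in one iteration, and dyadic sums *)

Section Probability.
Variable K : realType.

Lemma Pr_bind_verdict (A : Type) (p : rand verdict) (q : verdict -> rand A) (E : pred A) :
  Pr K (bind p q) E =
  Pr K p rejects * Pr K (q Reject) E + Pr K p (predC rejects) * Pr K (q Accept) E.
Proof.
elim: p => [[]|T k IH] /=; rewrite ?mul1r ?mul0r ?addr0 ?add0r //.
under eq_bigr do rewrite IH.
by rewrite big_split -!mulr_suml /=; ring.
Qed.

Lemma Pr_ge0 (A : Type) (p : rand A) (E : pred A) : 0 <= Pr K p E.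
Proof.
by elim: p => [a|T k IH] /=; rewrite ?ler0n // divr_ge0 ?ler0n // sumr_ge0.
Qed.

Lemma card_all_tuple (T : finType) (k : nat) (P : pred T) :
  (#|[set t : k.-tuple T | all P t]| <= #|[pred x | P x]| ^ k)%N.
Proof.
rewrite -[X in (_ ^ X)%N](card_ord k) -card_ffun_on.
rewrite -[X in (_ <= X)%N]cardsE.
set D := [set f in _].
apply: leq_trans (leq_imset_card (fun f : {ffun 'I_k -> T} => [tuple f i | i < k]) D).
apply: subset_leq_card; apply/subsetP=> t; rewrite inE => /allP tP.
apply/imsetP; exists [ffun i => tnth t i].
  by rewrite inE; apply/ffun_onP => i; rewrite ffunE inE; apply/tP/mem_tnth.
by apply: eq_from_tnth => i; rewrite tnth_mktuple ffunE.
Qed.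

(** From [1 + t <= expR t]: at [t = - 2^-r] it bounds the power by [expR (-3)], and at [t = 1] it
    gives [expR 1 >= 2]. *)
Lemma pow_one_sub_le (r : nat) : (1 - (2 ^+ r)^-1 : K) ^+ (3 * 2 ^ r) <= 8^-1.
Proof.
have r0 : 0 < 2 ^+ r :> K by rewrite exprn_gt0.
have h0 : 0 <= 1 - (2 ^+ r)^-1 :> K.
  by rewrite subr_ge0 invf_le1 // exprn_ege1 // ler1n.
have := expR_ge1Dx (- (2 ^+ r)^-1 : K).
move=> /(lerXn2r (3 * 2 ^ r)); rewrite !nnegrE => /(_ h0 (expR_ge0 _)) /le_trans; apply.
rewrite -expRM_natl natrM natrX mulrN mulfK ?gt_eqF // expRN lef_pV2 ?posrE ?expR_gt0 //.
rewrite -[3]mulr1 expRM_natl.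
have := expR_ge1Dx (1 : K); rewrite -[1 + 1]/2 => /(lerXn2r 3).
rewrite !nnegrE => /(_ (ler0n _ _) (expR_ge0 _)); apply: le_trans.
by rewrite -natrX.
Qed.

(** In the induction, either twice the new summand equals [2^-L] and replaces the old remainder, or
    [mu] is already below the new remainder. *)
Lemma dyadic_sum_ge (mu : K) (L : nat) : mu <= 1 ->
  mu <= (2 ^+ L)^-1 + 2 * \sum_(1 <= r < L.+1) (if (2 ^+ r)^-1 <= mu then (2 ^+ r)^-1 else 0).
Proof.
move=> mu1; elim: L => [|L IH]; first by rewrite big_geq // expr0 invr1 mulr0 addr0.
have [le|lt] := leP (2 ^+ L.+1)^-1 mu.
  rewrite big_nat_recr //= le mulrDr.
  have -> : 2 * (2 ^+ L.+1)^-1 = (2 ^+ L)^-1 :> K.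
    by rewrite exprS invfM mulrA mulfV ?mul1r // pnatr_eq0.
  have : 0 <= (2 ^+ L.+1)^-1 :> K by rewrite invr_ge0 exprn_ge0.
  lra.
apply: le_trans (ltW lt) _; rewrite lerDl mulr_ge0 // sumr_ge0 // => r _.
by case: ifP => // _; rewrite invr_ge0 exprn_ge0.
Qed.

Section Test.
Variables (d : Order.disp_t) (R : orderType d) (n : nat) (f : cube n -> R).
Hypothesis n_gt0 : (0 < n)%N.

Let N : nat := #|{: cube n}|.

Let N_gt0 : (0 < N)%N. Proof. by apply/card_gt0P; exists [ffun=> false]. Qed.

(** Total mass 1 relies on [n_gt0]: a draw from an empty ['I_n] would have mass 0. *)
Lemma Pr_iterationC (r : nat) :
  Pr K (iteration f r) (predC rejects) = 1 - Pr K (iteration f r) rejects.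
Proof.
apply/eqP; rewrite eq_sym subr_eq; apply/eqP => /=.
rewrite -mulrDl -big_split /= card_ord.
rewrite (eq_bigr (fun=> 1)) => [|i _]; last first.
  rewrite -mulrDl -big_split /= (eq_bigr (fun=> 1)) => [|t _].
    by rewrite sumr_const divff // pnatr_eq0 card_tuple -lt0n expn_gt0 N_gt0.
  by case: ifP; rewrite /= ?addr0 ?add0r.
by rewrite sumr_const card_ord divff // pnatr_eq0 -lt0n.
Qed.

Lemma Pr_run_until_rejectC (rs : seq nat) :
  1 - Pr K (run_until_reject [seq iteration f r | r <- rs]) rejects =
  \prod_(r <- rs) (1 - Pr K (iteration f r) rejects).
Proof.
elim: rs => [|r rs IH]; first by rewrite big_nil /= subr0.
rewrite big_cons -IH [X in 1 - X](Pr_bind_verdict (iteration f r)) Pr_iterationC [Pr K (Ret _) _]/=.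
by rewrite mulr1; ring.
Qed.

Definition minority i : K := (minn #|increases f i| #|decreases f i|)%:R / #|{: cube n}|%:R.

Lemma Pr_iteration_ge (r : nat) :
  n%:R^-1 * (\sum_i if (2 ^+ r)^-1 <= minority i then 3 / 4 else 0) <= Pr K (iteration f r) rejects.
Proof.
rewrite /= card_ord mulrC ler_wpM2r ?invr_ge0 ?ler0n //.
apply: ler_sum => i _; set k := (3 * 2 ^ r)%N.
set M := #|_|%:R; have M_def : M = N%:R ^+ k by rewrite /M card_tuple natrX.
have M_gt0 : 0 < M by rewrite M_def exprn_gt0 // ltr0n.
case: ifP => [mu_ge|_]; last first.
  apply: divr_ge0; last exact: ltW.
  by apply: sumr_ge0 => t _; case: ifP => _ /=; rewrite ?ler01.
rewrite ler_pdivlMr //.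
pose miss (P : pred (cube n)) := #|[set t : k.-tuple (cube n) | all (predC P) t]|.
have miss_le (P : pred (cube n)) (S : {set cube n}) :
    S =i P -> (minn #|increases f i| #|decreases f i| <= #|S|)%N -> (miss P)%:R <= 8^-1 * M.
  move=> SP le_S.
  have N0 : 0 < N%:R :> K by rewrite ltr0n.
  rewrite M_def; apply: (@le_trans _ _ ((1 - (2 ^+ r)^-1) ^+ k * N%:R ^+ k)); last first.
    by rewrite ler_wpM2r ?exprn_ge0 ?ler0n // pow_one_sub_le.
  rewrite -exprMn (@le_trans _ _ (#|predC P| ^ k)%:R) ?ler_nat ?card_all_tuple //.
  rewrite natrX lerXn2r ?nnegrE ?ler0n //.
    rewrite mulr_ge0 ?ler0n // subr_ge0 invf_le1 ?exprn_gt0 // exprn_ege1 // ler1n //.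
  have <- : (N - #|S|)%N = #|predC P|.
    by rewrite (eq_card SP) /N -[X in (X - _)%N](cardC P) addKn.
  rewrite natrB ?max_card // mulrBl mul1r lerD2l lerN2.
  by rewrite -ler_pdivlMr // (le_trans mu_ge) // /minority ler_pM2r ?invr_gt0 // ler_nat.
have miss_inc := miss_le (fun x => 0 < partial f i x) (increases f i) (in_set _) (geq_minl _ _).
have miss_dec := miss_le (fun x => partial f i x < 0) (decreases f i) (in_set _) (geq_minr _ _).
set hit := \sum_t _.
(* Union bound: a tuple that does not reject misses one of the two signs, and each miss costs at
   most [M / 8]. *)
suff : M <= hit + (miss (fun x => 0 < partial f i x))%:R + (miss (fun x => partial f i x < 0))%:R.
  by lra.
have cardE (S : {set k.-tuple (cube n)}) : #|S|%:R = \sum_t (t \in S)%:R :> K.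
  by rewrite -sum1_card natr_sum big_mkcond; apply: eq_bigr => t _; case: ifP.
have -> : M = \sum_(t : k.-tuple (cube n)) 1 by rewrite /M sumr_const.
rewrite /hit /miss !cardE -!big_split /=; apply: ler_sum => t _; rewrite !inE.
rewrite !all_predC; case: (has _ _); case: (has _ _) => /=.
all: rewrite ?addr0 ?add0r // lerDl ler01 //.
Qed.
End Test.
End Probability.

(** * Summing over all rounds of the test *)

Section Test.
Variables (K : realType) (d : Order.disp_t) (R : orderType d) (n : nat).
Variables (f : cube n -> R) (eps : K).
Hypotheses (n_gt0 : (0 < n)%N) (eps_gt0 : 0 < eps).

Lemma Pr_test_ge :
  1 - expR (- \sum_(1 <= r < (num_rounds n eps).+1)
                 (num_iterations n eps r)%:R * Pr K (iteration f r) rejects)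
    <= Pr K (unate_test f eps) rejects.
Proof.
rewrite /unate_test.
have -> : flatten [seq nseq (num_iterations n eps r) (iteration f r)
                  | r <- iota 1 (num_rounds n eps)] =
    map (iteration f) (flatten [seq nseq (num_iterations n eps r) r
                               | r <- iota 1 (num_rounds n eps)]).
  rewrite map_flatten -map_comp; congr flatten; apply: eq_map => r /=.
  by rewrite map_nseq.
rewrite lerBlDl -lerBlDr Pr_run_until_rejectC //.
apply: (@le_trans _ _ (\prod_(r <- flatten [seq nseq (num_iterations n eps r) r
      | r <- iota 1 (num_rounds n eps)]) expR (- Pr K (iteration f r) rejects))).
  (* The factors are nonnegative because they are acceptance probabilities. *)
  apply: ler_prod => r _; rewrite expR_ge1Dx andbT -Pr_iterationC //.
  apply: Pr_ge0.
rewrite -expR_sum ler_expR sumrN lerN2 big_flatten big_map /index_iota subSS subn0.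
apply: ler_sum => r _; rewrite big_nseq.
by rewrite iter_addr_0 mulr_natl.
Qed.

(** Truncating the dyadic sums at the last round thus loses at most [eps / 8] over all [n]
    directions. *)
Lemma num_rounds_ge : (2 ^+ num_rounds n eps)^-1 <= eps / (8 * n%:R).
Proof.
have x_gt0 : 0 < 8 * n%:R / eps by rewrite divr_gt0 // mulr_gt0 // ltr0n.
rewrite -[leRHS]invrK invf_div lef_pV2 ?posrE ?exprn_gt0 //.
rewrite -{1}(lnK x_gt0) -[2]lnK ?posrE // -expRM_natl ler_expR.
rewrite -ler_pdivrMr ?ln_gt0 ?ltr1n // (le_trans (ceil_ge _)) //.
by rewrite natr_absz ler_int ler_norm.
Qed.

Lemma num_iterations_ge (r : nat) :
  20 * n%:R / (eps * 2 ^+ r) <= (num_iterations n eps r)%:R.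
Proof. by rewrite (le_trans (ceil_ge _)) // natr_absz ler_int ler_norm. Qed.

(** The constant 15 is 20 times the 3/4 of a single iteration. The dyadic sums add up to at least
    [(eps - eps / 8) / 2 = 7 * eps / 16], and [15 * 7 / 16 > 1]. *)
Lemma sum_Pr_iterations_ge1 : far_from_unate eps f ->
  1 <= \sum_(1 <= r < (num_rounds n eps).+1)
         (num_iterations n eps r)%:R * Pr K (iteration f r) rejects.
Proof.
have arith (s W : K) : eps <= s -> s - eps / 8 <= 2 * W -> eps <= 15 * W.
  by have := eps_gt0; lra.
move=> /far_from_unate_le far; set L := num_rounds n eps.
pose N : nat := #|{: cube n}|.
have N_gt0 : 0 < N%:R :> K by rewrite ltr0n; apply/card_gt0P; exists [ffun=> false].
pose mu : 'I_n -> K := minority K f.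
have mu_sum : eps <= \sum_i mu i.
  by rewrite -mulr_suml ler_pdivlMr // -natr_sum.
pose w r i : K := if (2 ^+ r)^-1 <= mu i then (2 ^+ r)^-1 else 0.
have n0 : 0 < n%:R :> K by rewrite ltr0n.
have term_ge r : 15 / eps * \sum_i w r i <=
    (num_iterations n eps r)%:R * Pr K (iteration f r) rejects.
  apply: le_trans (ler_pM _ _ (num_iterations_ge r) (Pr_iteration_ge K f r)).
  - rewrite !mulr_sumr; apply: ler_sum => i _; rewrite /w /mu.
    case: ifP => _; last by rewrite !mulr0.
    rewrite le_eqVlt; apply/orP; left; apply/eqP; field.
    by rewrite !gt_eqF // exprn_gt0.
  - by rewrite divr_ge0 ?mulr_ge0 ?exprn_ge0 // ltW.
  - rewrite mulr_ge0 ?invr_ge0 ?(ltW n0) // sumr_ge0 // => i _.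
    by case: ifP => // _; rewrite divr_ge0.
apply: le_trans (ler_sum _ (fun r _ => term_ge r)).
rewrite -mulr_sumr exchange_big /=.
have mu_le i : mu i - eps / (8 * n%:R) <= 2 * \sum_(1 <= r < L.+1) w r i.
  have mu1 : mu i <= 1.
    by rewrite ler_pdivrMr // mul1r ler_nat (leq_trans (geq_minl _ _)) // max_card.
  rewrite lerBlDr [leRHS]addrC (le_trans (dyadic_sum_ge L mu1)) // lerD2r.
  exact: num_rounds_ge.
have : \sum_i (mu i - eps / (8 * n%:R)) <= \sum_i 2 * \sum_(1 <= r < L.+1) w r i.
  by apply: ler_sum => i _; apply: mu_le.
rewrite sumrB sumr_const card_ord -mulr_sumr.
have -> : eps / (8 * n%:R) *+ n = eps / 8.
  by rewrite -mulr_natr; field; rewrite gt_eqF.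
set W := \sum_i \sum_(1 <= r < L.+1) w r i => hW.
rewrite mulrAC ler_pdivlMr // mul1r.
exact: (arith _ _ mu_sum hW).
Qed.
End Test.

Theorem theorem3 (K : realType) (d : Order.disp_t) (R : orderType d) (n : nat)
    (f : cube n -> R) (eps : K)
    (eps_gt0 : 0 < eps) (eps_lt1 : eps < 1)
    (f_far : far_from_unate eps f) :
  1 - 1 / expR 1 <= Pr K (unate_test f eps) rejects.
Proof.
(* For [n = 0] every function is unate, and [f] is at distance 0 from itself. *)
have n_gt0 : (0 < n)%N.
  rewrite lt0n; apply/eqP=> n0; have /f_far : unate f by move=> [i i_lt]; exfalso; rewrite n0 in i_lt.
  rewrite (_ : [set x | _] = set0); last by apply/setP=> x; rewrite !inE eqxx.
  by rewrite cards0 mul0r leNgt eps_gt0.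
apply: le_trans (Pr_test_ge _ _ n_gt0).
rewrite div1r -expRN lerD2l lerN2 ler_expR lerN2.
exact: sum_Pr_iterations_ge1.
Qed.
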